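(* Let $TF$ be a T-exponential family on $\mathbb{R}$ whose dual $TF^*$ exists. Let $X_1,X_2,\ldots$ be independent random variables with the same distribution $P\in TF$ and mean $m_0$. For $m\in M_{F(P)}$ with $m_0<m$ define $$h(m_0,m)=-\lim_{n\to\infty}\frac1n\log\Pr\Big(\frac1n(X_1+\cdots+X_n)>m\Big).$$ Suppose that the dual probability $P^*$ of $P$ exists (that is, $P^*$ is a dual measure of $P$ which is a probability). Let $s_0=\ell'_{P^*}(m_0)$, $c=m_0\,\ell'_{P^*}(m_0)-\ell_{P^*}(m_0)$ and $P^*_{m_0}=e^{c}\,P^* * \delta_{s_0}$. Then $$\int_{\mathbb{R}}e^{-my}\,P^*_{m_0}(dy)=e^{h(m_0,m)} .$$
   Context: For a positive measure $\mu$ on $\mathbb{R}$ let $B_\mu(s)=\int_{\mathbb{R}}e^{-sx}\mu(dx)$, let $S(\mu)$ be the interior of $\{s: B_\mu(s)<\infty\}$, and $\ell_\mu=\log B_\mu$. $\mathcal{M}(\mathbb{R})$ is the set of positive (possibly unbounded) measures on $\mathbb{R}$ not concentrated on one point and with $S(\mu)\neq\emptyset$. The natural exponential family generated by $\mu\in\mathcal{M}(\mathbb{R})$ is $F(\mu)=\{P(-s,\mu): s\in S(\mu)\}$ with $P(-s,\mu)(dx)=e^{-sx-\ell_\mu(s)}\mu(dx)$; $M_{F(\mu)}=-\ell'_\mu(S(\mu))$ is the domain of the means. The T-exponential family generated by $\mu$ is the set of all translates $TF(\mu)=\{P(-s,\mu)*\delta_{a}: s\in S(\mu),\ a\in\mathbb{R}\}$.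 A measure $\mu^*\in\mathcal{M}(\mathbb{R})$ is a dual measure of $\mu$ if $M_{F(\mu)}\subset S(\mu^* )$ and $-\ell'_{\mu^*}(-\ell'_\mu(s))=s$ for all $s\in S(\mu)$ (unique up to a positive multiplicative constant). The dual $TF^*$ of $TF=TF(\mu)$ exists if $\mu$ has a dual measure $\mu^*$, and then $TF^*=TF(\mu^* )$. The limit defining $h(m_0,m)$ exists by Cramér's theorem. $*$ denotes convolution and $\delta_a$ the Dirac mass at $a$. *)

(* Defs.v *)
From HB Require Import structures.
From mathcomp Require Export all_boot all_order all_algebra.
From mathcomp Require Export all_classical all_reals all_analysis
  measurable_realfun.
Export Order.TTheory GRing.Theory Num.Theory.
Export numFieldNormedType.Exports.

Set Implicit Arguments.
Unset Strict Implicit.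
Unset Printing Implicit Defensive.

Local Open Scope classical_set_scope.
Local Open Scope ring_scope.

Section laplace.
Context {R : realType}.
Implicit Types (mu nu : {measure set (measurableTypeR R) -> \bar R}) (s : R).

Definition laplace mu s : \bar R := \int[mu]_x (expR (- (s * x)))%:E.

Definition laplace_domain mu : set R :=
  interior [set s | (laplace mu s < +oo)%E].

(* Only meaningful on [laplace_domain mu], where [laplace mu] is finite. *)
Definition log_laplace mu s : R := ln (fine (laplace mu s)).

(* The class M(R). The zero measure is excluded, being concentrated on any
   point. *)
Definition nef_basis mu : Prop :=
  (forall a : R, mu (~` [set a]) != 0%E) /\ laplace_domain mu !=set0.

(* M_{F(mu)}, the set of means of the natural exponential family F(mu). *)
Definition mean_domain mu : set R :=
  [set - derive1 (log_laplace mu) s | s in laplace_domain mu].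

Definition dual_measure mu nu : Prop :=
  [/\ nef_basis nu,
      mean_domain mu `<=` laplace_domain nu &
      forall s, laplace_domain mu s ->
        - derive1 (log_laplace nu) (- derive1 (log_laplace mu) s) = s].

End laplace.

(* P(-s, mu), the measure e^{-sx - l_mu(s)} mu(dx). *)
Section exp_tilt.
Local Open Scope ereal_scope.
Context {R : realType}.
Variables (mu : {measure set (measurableTypeR R) -> \bar R}) (s : R).

Definition exp_tilt (A : set (measurableTypeR R)) : \bar R :=
  \int[mu]_(x in A) (expR (- (s * x) - log_laplace mu s))%:E.

Let exp_tilt0 : exp_tilt set0 = 0.
Proof. by rewrite /exp_tilt integral_set0. Qed.

Let exp_tilt_ge0 A : 0 <= exp_tilt A.
Proof. by apply: integral_ge0 => x _; rewrite lee_fin expR_ge0. Qed.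

Let measurable_tilt : measurable_fun [set: measurableTypeR R]
  (fun x : measurableTypeR R => (expR (- (s * x) - log_laplace mu s))%:E).
Proof.
apply: (measurableT_comp (@EFin_measurable R setT)).
apply: (measurableT_comp (@measurable_expR R)); apply: measurable_funB => //.
by apply: measurableT_comp => //; exact: measurable_funM.
Qed.

Let exp_tilt_sigma_additive : semi_sigma_additive exp_tilt.
Proof.
move=> F mF tF mUF; rewrite /exp_tilt; apply: cvg_toP.
  apply: ereal_nondecreasing_is_cvgn => m n mn.
  apply: lee_sum_nneg_natr => // k _ _; apply: integral_ge0 => x _.
  by rewrite lee_fin expR_ge0.
rewrite ge0_integral_bigcup//.
exact: measurable_funTS measurable_tilt.
Qed.

HB.instance Definition _ := isMeasure.Build _ _ _ exp_tilt
  exp_tilt0 exp_tilt_ge0 exp_tilt_sigma_additive.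

End exp_tilt.

Section convolution.
Local Open Scope ereal_scope.
Context {R : realType}.
Variables (mu : {measure set (measurableTypeR R) -> \bar R})
  (nu : {sigma_finite_measure set (measurableTypeR R) -> \bar R}).

Definition convolution : set (measurableTypeR R) -> \bar R :=
  pushforward (mu \x nu)
    (fun p : measurableTypeR R * measurableTypeR R => (p.1 + p.2)%R).

Let measurable_add : measurable_fun setT
  (fun p : measurableTypeR R * measurableTypeR R =>
     (p.1 + p.2)%R : measurableTypeR R).
Proof. by apply: measurable_funD => //. Qed.

Let convolution0 : convolution set0 = 0.
Proof. by rewrite /convolution /pushforward preimage_set0 measure0. Qed.

Let convolution_ge0 A : 0 <= convolution A.
Proof. exact: measure_ge0. Qed.

Let convolution_sigma_additive : semi_sigma_additive convolution.
Proof.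
by move=> F mF tF mUF; apply: (@measure_semi_sigma_additive _ _ _
  (pushforward (mu \x nu) _ : {measure set _ -> \bar R})).
Qed.

HB.instance Definition _ := isMeasure.Build _ _ _ convolution
  convolution0 convolution_ge0 convolution_sigma_additive.

End convolution.

Section families.
Context {R : realType}.
Implicit Types (mu nu : {measure set (measurableTypeR R) -> \bar R})
  (TF : set (probability (measurableTypeR R) R)).

(* TF(mu); equality of measures is required on measurable sets only, as values
   outside the sigma-algebra carry no meaning. *)
Definition T_family mu : set (probability (measurableTypeR R) R) :=
  [set P | exists s a : R, laplace_domain mu s /\
     forall A, measurable A ->
       P A = convolution (exp_tilt mu s) \d_(a : measurableTypeR R) A].

Definition T_exponential_family TF : Prop :=
  exists mu, nef_basis mu /\ TF = T_family mu.

Definition dual_T_family TF TFstar : Prop :=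
  exists mu nu, [/\ nef_basis mu, dual_measure mu nu,
    TF = T_family mu & TFstar = T_family nu].

End families.

Section sequences_of_random_variables.
Context d (Omega : measurableType d) (R : realType) (Pr : probability Omega R).
Implicit Type X : nat -> {RV Pr >-> R}.

Definition mutually_independent X : Prop :=
  forall (J : seq nat) (B : nat -> set R),
    uniq J -> (forall j, measurable (B j)) ->
    Pr (\bigcap_(j in [set` J]) (X j @^-1` B j)) =
    (\prod_(j <- J) Pr (X j @^-1` B j))%E.

(* The rate h(m_0, m); [X i] is the (i+1)-st variable. Logarithm and limit are
   taken in [\bar R], so that log 0 = -oo. *)
Definition deviation_rate X (m : R) : \bar R :=
  (- limn (fun n : nat => n%:R^-1%:E *
     lne (Pr [set w | (m < n%:R^-1 * \sum_(i < n) X i w)%R])))%E.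

End sequences_of_random_variables.

(* Main.v *)
Require Import Defs.
From mathcomp Require Import ring lra.

Set Implicit Arguments.
Unset Strict Implicit.
Unset Printing Implicit Defensive.

Local Open Scope classical_set_scope.
Local Open Scope ring_scope.

Import HBNNSimple.

(** Write [lP], [lQ] for the log-Laplace transforms of [P] and of its dual
    probability [Q], and [k = - lP'], so that the measure
    [expR (- s x - lP s) P(dx)] has mean [k s] and [k 0 = m0]. Choose [s] with
    [k s = m]; it is negative because [k] decreases and [m0 < m].

    Both sides of the formula are expressed through these functions. At [0] the
    duality [lQ' (k s) = - s] reads [lQ' m0 = 0]: hence [s0 = 0],
    [c = - lQ m0], and the left side is [expR (lQ m - lQ m0)]. On the right,
    Cramer's theorem gives the rate [- (s m + lP s)] (lemma [cramer]). What
    remains is [lQ m + s m + lP s = lQ m0], Legendre duality: along the curve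
    [m = k s] the differential of [lQ m + s m + lP s] is
    [lQ' m dm + s dm + m ds + lP' ds = 0], so this quantity has at [s] the
    value it has at [0] (lemma [legendre_dual_constant]). The family enters
    through [T_family_laplace_domain0]: a translate of a tilted law has a
    Laplace transform that is finite around [0].

    All convexity is drawn from the tangent inequality
    [l t >= l s + l' s (t - s)], which is Jensen's inequality for the tilted
    law ([log_laplace_tangent]); it is strict between points of different
    slope, and the duality makes the slope of [lP] injective.

    In Cramer's theorem the upper bound is Chernoff's. For the lower bound the
    law is tilted by a parameter [s1] slightly below [s], whose mean lies
    slightly above [m]; the usual law of large numbers for the tilted law is
    replaced by exponential bounds of its two tails, so that nothing is needed
    about the sum [S n] beyond the identity
    [E (expR (- t S n)) = (laplace P t) ^ n] ([laplace_sum]). Independence,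
    which is given for events only, yields this identity by passing from
    indicators to exponentials one variable at a time
    ([ge0_integral_image_density]). *)

(** * Laplace transforms *)

Section laplace_theory.
Context {R : realType}.
Implicit Types (mu : {measure set (measurableTypeR R) -> \bar R}) (s t : R).

Lemma measurable_laplace_kernel s :
  measurable_fun [set: measurableTypeR R]
    (fun x : measurableTypeR R => expR (- (s * x))).
Proof.
by apply: (measurableT_comp (@measurable_expR R)); apply: measurableT_comp.
Qed.

Lemma laplace_ge0 mu s : (0 <= laplace mu s)%E.
Proof. by apply: integral_ge0 => x _; rewrite lee_fin expR_ge0. Qed.

Lemma laplace_fin_num mu s :
  (laplace mu s < +oo)%E -> laplace mu s \is a fin_num.
Proof. by move=> h; rewrite ge0_fin_numE// laplace_ge0. Qed.

Lemma laplace_kernel_integrable mu s : (laplace mu s < +oo)%E ->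
  mu.-integrable setT (EFin \o (fun x : R => expR (- (s * x)))).
Proof.
move=> h; apply/integrableP; split.
  by apply/measurable_EFinP; exact: measurable_laplace_kernel.
apply: le_lt_trans h; rewrite le_eqVlt; apply/orP; left; apply/eqP.
by apply: eq_integral => x _ /=; rewrite ger0_norm// expR_ge0.
Qed.

Lemma laplace_domain_lt_pinfty mu s :
  laplace_domain mu s -> (laplace mu s < +oo)%E.
Proof. exact: (@interior_subset _ [set s | (laplace mu s < +oo)%E]). Qed.

Lemma laplace_domain_ball mu s : laplace_domain mu s ->
  exists2 r, 0 < r & forall t, `|s - t| <= r -> (laplace mu t < +oo)%E.
Proof.
move=> /nbhs_ballP[r /= r0 sr]; exists (r / 2); first by rewrite divr_gt0.
move=> t st; apply: (sr t); rewrite /ball/= (le_lt_trans st)//; lra.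
Qed.

Lemma laplace_domain_itvoo mu s : laplace_domain mu s ->
  exists2 r, 0 < r & forall t, t \in `]s - r, s + r[ -> laplace_domain mu t.
Proof.
move=> ds; have /nbhs_ballP[r /= r0 sr] : nbhs s (laplace_domain mu).
  by apply: open_nbhs_nbhs; split => //; exact: open_interior.
by exists r => // t; rewrite in_itv/= -ltr_distlC => /sr.
Qed.

(** The exponential of a point between [s] and [t] is at most the larger of the
    two end exponentials. *)
Lemma laplace_le_endpoints mu s t u : s <= u <= t ->
  (laplace mu u <= laplace mu s + laplace mu t)%E.
Proof.
move=> /andP[su ut]; have mexp v : measurable_fun [set: measurableTypeR R]
    (fun x : measurableTypeR R => (expR (- (v * x)))%:E).
  by apply/measurable_EFinP; exact: measurable_laplace_kernel.
have exp0 v (x : R) : (0 <= (expR (- (v * x)))%:E)%E.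
  by rewrite lee_fin expR_ge0.
rewrite /laplace -ge0_integralD//; apply: ge0_le_integral => //.
  exact: emeasurable_funD.
move=> x _; rewrite -EFinD lee_fin; have [x0|x0] := leP 0 x.
  by rewrite ler_wpDr ?expR_ge0// ler_expR; nra.
by rewrite ler_wpDl ?expR_ge0// ler_expR; nra.
Qed.

Lemma laplace_domain_itv mu s t u : laplace_domain mu s ->
  laplace_domain mu t -> s <= u <= t -> laplace_domain mu u.
Proof.
move=> ds dt /andP[]; rewrite le_eqVlt => /predU1P[<-//|su].
rewrite le_eqVlt => /predU1P[->//|ut].
have st := lt_trans su ut.
apply: (@filterS _ _ _ `]s, t[%classic); last first.
  by apply: near_in_itvoo; rewrite in_itv/= su.
move=> v /=; rewrite in_itv/= => /andP[sv vt].
apply: le_lt_trans (laplace_le_endpoints mu (_ : s <= v <= t)) _.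
  by rewrite !ltW.
by rewrite lte_add_pinfty//; exact: laplace_domain_lt_pinfty.
Qed.

Lemma is_derive_laplace_kernel s x :
  is_derive s (1 : R) (fun s => expR (- (s * x))) (- x * expR (- (s * x))).
Proof. by apply: is_derive_eq; rewrite /GRing.scale/=; ring. Qed.

(** A factor [x] costs an arbitrarily small change of the parameter, since
    [r |x| <= expR (r |x|)]. *)
Lemma laplace_moment_bound (r s u x : R) : 0 < r -> `|s - u| <= r ->
  `|- x * expR (- (u * x))| <=
    r^-1 * (expR (- ((s - 2 * r) * x)) + expR (- ((s + 2 * r) * x))).
Proof.
move=> r0; rewrite ler_distl => /andP[ru ur].
rewrite normrM normrN (ger0_norm (expR_ge0 _)) ler_pdivlMl//.
have rx : r * `|x| <= expR (r * `|x|).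
  by rewrite (le_trans _ (expR_ge1Dx _))// lerDr.
rewrite mulrA (le_trans (ler_wpM2r (expR_ge0 _) rx))// -expRD.
have [x0|x0] := leP 0 x.
  by rewrite ler_wpDr ?expR_ge0// ler_expR (ger0_norm x0); nra.
by rewrite ler_wpDl ?expR_ge0// ler_expR (ltr0_norm x0); nra.
Qed.

Let laplace_dominated mu s : laplace_domain mu s ->
  exists r G, [/\ 0 < r, mu.-integrable setT (EFin \o G),
   forall x, 0 <= G x,
   forall u, `|s - u| <= r -> (laplace mu u < +oo)%E &
   forall u x, `|s - u| <= r -> `|- x * expR (- (u * x))| <= G x].
Proof.
move=> /laplace_domain_ball[r r0 sr].
exists (r / 2), (fun x => (r / 2)^-1 * (expR (- ((s - 2 * (r / 2)) * x)) +
   expR (- ((s + 2 * (r / 2)) * x)))); split.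
- by rewrite divr_gt0.
- apply: (@eq_integrable _ _ _ mu _ measurableT (fun x : R => (r/2)^-1%:E *
     ((EFin \o (fun x : R => expR (- ((s - 2 * (r / 2)) * x)))) x +
      (EFin \o (fun x : R => expR (- ((s + 2 * (r / 2)) * x)))) x))%E) => //.
  apply: integrableZl => //; apply: integrableD => //;
    apply: laplace_kernel_integrable; apply: sr.
  + by rewrite ler_distl; apply/andP; split; lra.
  + by rewrite ler_distl; apply/andP; split; lra.
- by move=> x; rewrite mulr_ge0 ?addr_ge0 ?expR_ge0// invr_ge0 divr_ge0// ltW.
- by move=> u ur; apply: sr; rewrite (le_trans ur)//; lra.
- by move=> u x ur; apply: laplace_moment_bound => //; rewrite divr_gt0.
Qed.

Lemma laplace_moment_integrable mu s : laplace_domain mu s ->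
  mu.-integrable setT (EFin \o (fun x : R => - x * expR (- (s * x)))).
Proof.
move=> /laplace_dominated[r [G [r0 iG _ _ Gub]]].
apply: (le_integrable measurableT) iG.
  apply/measurable_EFinP; apply: measurable_funM; last first.
    exact: measurable_laplace_kernel.
  exact: oppr_measurable.
move=> x _; rewrite lee_fin; apply: le_trans (ler_norm _).
by apply: Gub; rewrite subrr normr0 ltW.
Qed.

Lemma is_derive_laplace mu s : laplace_domain mu s ->
  is_derive s (1 : R) (fun s => fine (laplace mu s))
    (\int[mu]_x (- x * expR (- (s * x))))%R.
Proof.
move=> /laplace_dominated[r [G [r0 iG G0 fin Gub]]].
pose f := fun (s : R) (x : measurableTypeR R) => expR (- (s * x)).
have df x y : is_derive x (1 : R) (f ^~ y) (- y * expR (- (x * y))).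
  exact: is_derive_laplace_kernel.
have d1f x y : partial1of2 f x y = - y * expR (- (x * y)).
  by rewrite partial1of2E; exact: derive_val.
have inr u : `]s - r, s + r[%classic u -> `|s - u| <= r.
  by rewrite /= in_itv/= ler_distl => /andP[? ?]; apply/andP; split; lra.
have sI : `]s - r, s + r[%classic s.
  by rewrite /= in_itv/=; apply/andP; split; lra.
have fI u : `]s - r, s + r[%classic u -> mu.-integrable setT (EFin \o f u).
  by move=> /inr/fin; exact: laplace_kernel_integrable.
have fD u y : `]s - r, s + r[%classic u -> setT y -> derivable (f ^~ y) u 1.
  by move=> _ _; exact: ex_derive.
have fG u y : `]s - r, s + r[%classic u -> setT y -> `|partial1of2 f u y| <= G y.
  by move=> /inr ur _; rewrite d1f; exact: Gub.
have der := derivable_under_integral measurableT sI fI fD G0 iG fG.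
have val := differentiation_under_integral measurableT sI fI fD G0 iG fG.
apply: DeriveDef; first exact: der.
rewrite -derive1E.
transitivity (derive1 (fun x' : R => (\int[mu]_y f x' y)%R) s); first by [].
by rewrite val; apply: eq_Rintegral => x _; rewrite d1f.
Qed.

End laplace_theory.

Lemma derive1_supporting_line (R : realType) (f : R -> R) (c t r : R) :
  0 < r -> (forall u, u \in `]t - r, t + r[ -> derivable f u 1) ->
  (forall u, u \in `]t - r, t + r[ -> f t + c * (u - t) <= f u) ->
  derive1 f t = c.
Proof.
move=> r0 df supp; pose g : R -> R := f - (fun u => c * u).
have dg u : u \in `]t - r, t + r[ -> is_derive u (1 : R) g (derive1 f u - c).
  move=> /df/derivableP; rewrite -derive1E => du; apply: is_deriveB.
  by apply: is_derive_eq; rewrite /GRing.scale/= mulr1.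
have tr : t \in `]t - r, t + r[ by rewrite in_itv/= -ltr_distlC subrr normr0.
have trr : t - r <= t + r by lra.
have gmin u : u \in `]t - r, t + r[ -> g t <= g u.
  by move=> /supp; rewrite /g /= !fctE; lra.
have dg0 := derive1_at_min trr
  (fun u ur => @ex_derive _ _ _ _ _ _ _ (dg u ur)) tr gmin.
have /eqP := etrans (esym (@derive_val _ _ _ _ _ _ _ (dg t tr)))
  (@derive_val _ _ _ _ _ _ _ dg0).
by rewrite subr_eq0 => /eqP.
Qed.

Section log_laplace_theory.
Context {R : realType}.
Implicit Types (nu : probability (measurableTypeR R) R) (s t : R).

Lemma laplace_gt0 nu s : (0 < laplace nu s)%E.
Proof.
rewrite lt_neqAle laplace_ge0 andbT eq_sym; apply/eqP => B0.
have mexp : measurable_fun [set: measurableTypeR R]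
    (EFin \o (fun x : measurableTypeR R => expR (- (s * x)))).
  by apply/measurable_EFinP; exact: measurable_laplace_kernel.
have /(ae_eq_integral_abs nu measurableT mexp) [N [mN N0 subN]] :
    (\int[nu]_x `|(EFin \o (fun x => expR (- (s * x)))) x| = 0)%E.
  by rewrite -[RHS]B0; apply: eq_integral => x _ /=; rewrite ger0_norm ?expR_ge0.
have NT : N = setT.
  apply/seteqP; split=> // x _; apply: subN => /= /(_ Logic.I) [] /eqP.
  by rewrite expR_eq0.
have : nu setT = 0%E by rewrite -NT; exact: N0.
by rewrite probability_setT => /eqP; rewrite onee_eq0.
Qed.

Lemma expR_log_laplace nu s : (laplace nu s < +oo)%E ->
  expR (log_laplace nu s) = fine (laplace nu s).
Proof. by move=> fs; rewrite lnK// posrE fine_gt0// laplace_gt0. Qed.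

Lemma is_derive_log_laplace nu s : laplace_domain nu s ->
  is_derive s (1 : R) (log_laplace nu)
    ((fine (laplace nu s))^-1 * (\int[nu]_x (- x * expR (- (s * x))))%R).
Proof.
move=> ds; have dB := is_derive_laplace ds.
have B0 : 0 < fine (laplace nu s).
  by rewrite fine_gt0// laplace_gt0 laplace_domain_lt_pinfty.
exact: (is_derive1_comp (is_derive1_ln B0) dB).
Qed.

Lemma derive1_log_laplace nu s : laplace_domain nu s ->
  derive1 (log_laplace nu) s =
  (fine (laplace nu s))^-1 * (\int[nu]_x (- x * expR (- (s * x))))%R.
Proof.
by move=> ds; rewrite derive1E; have ? := is_derive_log_laplace ds;
  exact: derive_val.
Qed.

Lemma derivable_log_laplace nu s : laplace_domain nu s ->
  derivable (log_laplace nu) s 1.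
Proof.
by move=> ds; have ? := is_derive_log_laplace ds; exact: ex_derive.
Qed.

(** Jensen's inequality for the law proportional to [expR (- (s * x)) nu(dx)],
    whose mean is minus the slope at [s]. *)
Lemma log_laplace_tangent nu s t :
  laplace_domain nu s -> (laplace nu t < +oo)%E ->
  log_laplace nu s + derive1 (log_laplace nu) s * (t - s) <= log_laplace nu t.
Proof.
move=> ds ft; have fs := laplace_domain_lt_pinfty ds.
set b' := (\int[nu]_x (- x * expR (- (s * x))))%R.
rewrite derive1_log_laplace// -/b'; set b := fine (laplace nu s).
set a := b^-1 * b'.
have b0 : 0 < b by rewrite fine_gt0// laplace_gt0.
rewrite -ler_expR expRD (expR_log_laplace fs) (expR_log_laplace ft) -/b.
set K := expR (a * (t - s)).
pose k1 := K * (1 - (t - s) * a); pose k2 := K * (t - s).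
have i1 := laplace_kernel_integrable fs.
have i2 := laplace_moment_integrable ds.
have iZ (k : R) (f : R -> R) : nu.-integrable setT (EFin \o f) ->
    nu.-integrable setT (EFin \o (fun x => k * f x)).
  move=> fi; apply: (@eq_integrable _ _ _ nu _ measurableT
    (fun x : R => k%:E * (EFin \o f) x)%E) => //.
  exact: integrableZl.
have -> : b * K = (\int[nu]_x (k1 * expR (- (s * x)) +
                               k2 * (- x * expR (- (s * x)))))%R.
  rewrite RintegralD//; [|exact: iZ|exact: iZ].
  rewrite RintegralZl// RintegralZl// -/b'.
  have -> : b' = b * a by rewrite /a mulrA mulfV ?mul1r// gt_eqF.
  rewrite [X in k1 * X](_ : _ = b)//.
  rewrite /k1 /k2; ring.
apply: le_Rintegral => //.
- apply: (@eq_integrable _ _ _ nu _ measurableT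
   (fun x : R => (k1 * expR (- (s * x)))%:E +
                 (k2 * (- x * expR (- (s * x))))%:E)%E) => //.
  by apply: integrableD => //; exact: iZ.
- exact: laplace_kernel_integrable.
move=> x _; have -> : expR (- (t * x)) =
    K * expR (- (s * x)) * expR ((t - s) * (- x - a)).
  by rewrite /K -!expRD; congr expR; ring.
have := expR_ge1Dx ((t - s) * (- x - a)).
have : 0 <= K * expR (- (s * x)) by rewrite mulr_ge0 ?expR_ge0.
move=> /ler_wpM2l /[apply]; apply: le_trans.
by rewrite /k1 /k2 le_eqVlt; apply/orP; left; apply/eqP; ring.
Qed.

Lemma log_laplace_slope_le nu s t : laplace_domain nu s ->
  laplace_domain nu t -> s <= t ->
  derive1 (log_laplace nu) s <= derive1 (log_laplace nu) t.
Proof.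
move=> ds dt; rewrite le_eqVlt => /predU1P[->//|st].
have ts : 0 < t - s by rewrite subr_gt0.
have := log_laplace_tangent ds (laplace_domain_lt_pinfty dt).
have := log_laplace_tangent dt (laplace_domain_lt_pinfty ds).
move: (derive1 _ s) (derive1 _ t) (log_laplace _ s) (log_laplace _ t).
by move=> a b c d ? ?; rewrite -(ler_pM2r ts); lra.
Qed.

(** If the tangent at [s] met the graph again at [t], it would support the graph
    there, and the slope at [t] would be that of the line. *)
Lemma log_laplace_tangent_strict nu s t :
  laplace_domain nu s -> laplace_domain nu t ->
  derive1 (log_laplace nu) s != derive1 (log_laplace nu) t ->
  log_laplace nu s + derive1 (log_laplace nu) s * (t - s) < log_laplace nu t.
Proof.
move=> ds dt st; have ft := laplace_domain_lt_pinfty dt.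
rewrite lt_neqAle log_laplace_tangent// andbT; apply: contra st => /eqP touch.
have [r r0 inr] := laplace_domain_itvoo dt.
apply/eqP; symmetry; apply: (derive1_supporting_line r0).
  by move=> u /inr; exact: derivable_log_laplace.
move=> u /inr/laplace_domain_lt_pinfty/(log_laplace_tangent ds).
by apply: le_trans; rewrite -touch -addrA -mulrDr [t - s + _]addrC subrKA.
Qed.

End log_laplace_theory.

(** * Legendre duality *)

(** On a subdivision of mesh [h] the increments of [G] add up to at most
    [h * (k a - k b)], and [h] is arbitrary. *)
Lemma constant_of_increments (R : realType) (G k : R -> R) (a b : R) :
  a <= b ->
  (forall x y, a <= x -> x <= y -> y <= b ->
     `|G y - G x| <= (y - x) * (k x - k y)) ->
  G a = G b.
Proof.
move=> ab incr.
have bound (N : nat) :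
    `|G b - G a| <= (b - a) * (k a - k b) / N.+1%:R.
  pose h := (b - a) / N.+1%:R.
  have N0 : (N.+1%:R : R) != 0 by rewrite pnatr_eq0.
  have h0 : 0 <= h by rewrite divr_ge0// subr_ge0.
  suff step (i : nat) : (i <= N.+1)%N ->
      `|G (a + i%:R * h) - G a| <= h * (k a - k (a + i%:R * h)).
    have := step N.+1 (leqnn _).
    have -> : a + N.+1%:R * h = b by rewrite /h mulrC divfK// addrC subrK.
    by rewrite mulrAC.
  elim: i => [_|i IH iN].
    by rewrite mul0r addr0 !subrr normr0 mulr0.
  have := IH (ltnW iN); set x := a + i%:R * h.
  have -> : a + i.+1%:R * h = x + h by rewrite /x -natr1; ring.
  have xb : x + h <= b.
    rewrite /x -addrA -{2}[h]mul1r -mulrDl natr1 -lerBrDl.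
    by rewrite /h mulrA ler_pdivrMr ?ltr0n// mulrC ler_wpM2l ?subr_ge0 ?ler_nat.
  have ax : a <= x by rewrite lerDl mulr_ge0.
  have xh : x <= x + h by rewrite lerDl.
  have := incr x (x + h) ax xh xb; rewrite [x + h - x]addrAC subrr add0r.
  move=> /lerD /[apply] /(le_trans (ler_normD _ _)).
  by rewrite subrKA -mulrDr [_ - _ + _]addrC subrKA.
apply/eqP; rewrite eq_sym -subr_eq0 -normr_le0 leNgt; apply/negP => e0.
set e := `|G b - G a| in bound e0.
have := bound (Num.truncn ((b - a) * (k a - k b) / e)).
rewrite ler_pdivlMr// mulrC -ler_pdivlMr// leNgt.
by rewrite truncnS_gt.
Qed.

(** With [kx], [px], [qx] the values at [x] of [k], [lP] and [lQ o k], the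
    hypotheses are the four tangent inequalities between two points. *)
Lemma legendre_increment (R : realType) (x y kx ky px py qx qy : R) :
  px - kx * (y - x) <= py -> py - ky * (x - y) <= px ->
  qx - x * (ky - kx) <= qy -> qy - y * (kx - ky) <= qx ->
  `|(qy + y * ky + py) - (qx + x * kx + px)| <= (y - x) * (kx - ky).
Proof.
by move=> ? ? ? ?; rewrite ler_distl; apply/andP; split; lra.
Qed.

Section legendre_duality.
Context {R : realType}.
Variables P Q : probability (measurableTypeR R) R.
Hypothesis PQ : dual_measure P Q.

Local Notation k s := (- derive1 (log_laplace P) s).

Let k_dom s : laplace_domain P s -> laplace_domain Q (k s).
Proof. by case: PQ => _ PQ' _ ds; apply: PQ'; exists s. Qed.

Let slope_dual s : laplace_domain P s -> derive1 (log_laplace Q) (k s) = - s.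
Proof. by case: PQ => _ _ PQ' ds; rewrite -{2}(PQ' _ ds) opprK. Qed.

Lemma dual_slope_inj s t : laplace_domain P s -> laplace_domain P t ->
  derive1 (log_laplace P) s = derive1 (log_laplace P) t -> s = t.
Proof.
move=> /slope_dual ds /slope_dual dt st; apply: oppr_inj.
by rewrite -ds -dt st.
Qed.

Let tangent s t : laplace_domain P s -> laplace_domain P t ->
  log_laplace P s - k s * (t - s) <= log_laplace P t.
Proof.
move=> ds dt; rewrite mulNr opprK.
exact: log_laplace_tangent ds (laplace_domain_lt_pinfty dt).
Qed.

Let dual_tangent s t : laplace_domain P s -> laplace_domain P t ->
  log_laplace Q (k s) - s * (k t - k s) <= log_laplace Q (k t).
Proof.
move=> ds dt; rewrite -mulNr -(slope_dual ds).
exact: log_laplace_tangent (k_dom ds) (laplace_domain_lt_pinfty (k_dom dt)).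
Qed.

(** The tangent inequalities bound the increments by a product of increments of
    [s] and [k s], which spares the derivative of [k]. *)
Lemma legendre_dual_constant s t a b :
  laplace_domain P s -> laplace_domain P t -> s <= t -> k s = a -> k t = b ->
  log_laplace Q a + s * a + log_laplace P s =
  log_laplace Q b + t * b + log_laplace P t.
Proof.
move=> ds dt st <- <-.
apply: (@constant_of_increments _ (fun s => log_laplace Q (k s) + s * k s +
  log_laplace P s) (fun s => k s)) => // x y sx xy yt.
have dx : laplace_domain P x.
  by apply: laplace_domain_itv ds dt _; rewrite sx (le_trans xy).
have dy : laplace_domain P y.
  by apply: laplace_domain_itv ds dt _; rewrite yt (le_trans sx).
exact: legendre_increment (tangent dx dy) (tangent dy dx)
  (dual_tangent dx dy) (dual_tangent dy dx).
Qed.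

End legendre_duality.

(** * Sums of independent variables *)

(** Equality on indicator functions passes to simple functions by linearity and
    to nonnegative functions by monotone convergence. *)
Lemma ge0_integral_image_density d1 d2 (S : measurableType d1)
    (T : measurableType d2) (R : realType) (mu : {measure set S -> \bar R})
    (nu : {measure set T -> \bar R}) (Y : S -> T) (g : S -> R) (f : T -> \bar R) :
  measurable_fun setT Y -> measurable_fun setT g -> (forall w, 0 <= g w) ->
  (forall A, measurable A -> (\int[mu]_(w in Y @^-1` A) (g w)%:E = nu A)%E) ->
  measurable_fun setT f -> (forall y, (0 <= f y)%E) ->
  (\int[mu]_w (f (Y w) * (g w)%:E) = \int[nu]_y f y)%E.
Proof.
move=> mY mg g0 gnu mf f0; pose h := nnsfun_approx measurableT mf.
have nd y : {homo (fun n => h n y) : n m / (n <= m)%N >-> n <= m}.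
  by move=> n m nm; exact/lefP/nd_nnsfun_approx.
have hf y : (EFin \o (fun n => h n y)) n @[n --> \oo] --> f y.
  exact: cvg_nnsfun_approx.
have mYA A : measurable A -> measurable (Y @^-1` A).
  by move=> mA; rewrite -[_ @^-1` _]setTI; exact: mY.
rewrite (nd_ge0_integral_lim nu f0 nd hf).
transitivity (\int[mu]_w limn (fun n => (h n (Y w))%:E * (g w)%:E))%E.
  apply: eq_integral => w _; apply/esym/cvg_lim => //; apply: cvgeZr => //.
  exact: hf.
rewrite monotone_convergence//; last 3 first.
- move=> n; apply: emeasurable_funM; last exact/measurable_EFinP.
  by apply/measurable_EFinP; exact: measurableT_comp.
- by move=> n w _; rewrite mule_ge0// lee_fin.
- move=> w _ n m nm; rewrite lee_wpmul2r ?lee_fin//; exact: nd.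
congr (limn _); apply/funext => n /=; rewrite sintegralE.
transitivity (\int[mu]_w (\sum_(y \in range (h n))
    (y%:E * ((\1_(Y @^-1` (h n @^-1` [set y])) w * g w)%:E))))%E.
  apply: eq_integral => w _; rewrite fimfunE -fsumEFin//.
  rewrite ge0_mule_fsuml; last by move=> y; exact: nnfun_muleindic_ge0.
  by apply: eq_fsbigr => y _; rewrite -!EFinM mulrA.
have mind y : measurable_fun setT
    (fun w => \1_(Y @^-1` (h n @^-1` [set y])) w * g w).
  by apply: measurable_funM => //; apply: measurable_indic; exact: mYA.
rewrite ge0_integral_fsum//; last 2 first.
- move=> y; apply: measurable_funeM; exact/measurable_EFinP.
- move=> y w _; have [y0|y0] := leP 0 y.
    by rewrite mule_ge0// lee_fin mulr_ge0.
  by rewrite preimage_nnfun0// preimage_set0 indic0 mul0r mule0.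
apply: eq_fsbigr => y _; have [y0|y0] := leP 0 y; last first.
  by rewrite preimage_nnfun0// preimage_set0 measure0 mule0
    integral0_eq// => w _; rewrite indic0 mul0r mule0.
rewrite ge0_integralZl_EFin//; last 2 first.
- by move=> w _; rewrite lee_fin mulr_ge0.
- exact/measurable_EFinP.
congr (_ * _)%E; rewrite -gnu//.
rewrite [RHS]integral_mkcond; apply: eq_integral => w _.
by rewrite patchE indicE; case: ifPn => wA; rewrite ?mul1r ?mul0r.
Qed.

Section independent_sums.
Context d (Omega : measurableType d) (R : realType) (Pr : probability Omega R).
Variables (X : nat -> {RV Pr >-> R}) (P : probability (measurableTypeR R) R).
Hypothesis X_indep : mutually_independent X.
Hypothesis X_distr :
  forall i A, measurable A -> distribution Pr (X i) A = P A.

Let preimage_measurable j (A : set R) : measurable A ->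
  measurable (X j @^-1` A).
Proof. by move=> mA; rewrite -[_ @^-1` _]setTI; exact: measurable_funP. Qed.

Lemma measurable_laplace_sum s n : measurable_fun [set: Omega]
  (fun w => expR (- (s * \sum_(i < n) X i w))).
Proof.
apply: (measurableT_comp (@measurable_expR R)); apply: measurableT_comp => //.
by apply: measurable_funM => //; exact: measurable_sum.
Qed.

(** The generalization to an event [D] depending on later variables makes the
    induction on [k] possible: on sets, independence of [X k] from [D] is the
    statement at [k] for [D] intersected with an event about [X k]. *)
Let laplace_sum_on s : (laplace P s < +oo)%E ->
  forall k (J : seq nat) (B : nat -> set R), uniq J ->
    all (leq k) J -> (forall j, measurable (B j)) ->
  (\int[Pr]_(w in \bigcap_(j in [set` J]) (X j @^-1` B j))
     (expR (- (s * \sum_(i < k) X i w)))%:E =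
   (fine (laplace P s) ^+ k)%:E * \prod_(j <- J) Pr (X j @^-1` B j))%E.
Proof.
move=> fs; set L := fine (laplace P s).
have L0 : 0 <= L by rewrite fine_ge0// laplace_ge0.
elim=> [|k IH] J B uJ kJ mB; set D := \bigcap_(_ in _) _.
- have mD : measurable D.
    by apply: bigcap_measurableType => j _; exact: preimage_measurable.
  under eq_integral do rewrite big_ord0 mulr0 oppr0 expR0.
  by rewrite integral_cst// mul1e expr0 mul1e; exact: X_indep.
have mD : measurable D.
  by apply: bigcap_measurableType => j _; exact: preimage_measurable.
have kNJ : k \notin J by apply/negP => /(allP kJ); rewrite ltnn.
pose p := (\prod_(j <- J) Pr (X j @^-1` B j))%E.
have [q q0 pE] : exists2 q, 0 <= q & p = q%:E.
  exists (fine p); first by rewrite fine_ge0// prode_ge0.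
  rewrite fineK//; apply: prode_fin_num => j _.
  by apply: fin_num_measure; exact: preimage_measurable.
have c0 : 0 <= L ^+ k * q by rewrite mulr_ge0 ?exprn_ge0.
pose g w := expR (- (s * \sum_(i < k) X i w)) * \1_D w.
have g0 w : 0 <= g w by rewrite mulr_ge0 ?expR_ge0.
have mg : measurable_fun setT g.
  by apply: measurable_funM => //; exact: measurable_laplace_sum.
have gP (A : set R) : measurable A ->
    (\int[Pr]_(w in X k @^-1` A) (g w)%:E = mscale (NngNum c0) P A)%E.
  move=> mA; pose B' j := if j == k then A else B j.
  have mB' j : measurable (B' j) by rewrite /B'; case: ifP.
  have ukJ : uniq (k :: J) by rewrite /= kNJ.
  have kkJ : all (leq k) (k :: J).
    by rewrite /= leqnn; apply: sub_all kJ => j; exact: ltnW.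
  have := IH (k :: J) B' ukJ kkJ mB'; rewrite big_cons {2}/B' eqxx.
  have JB' : {in J, forall j, B' j = B j}.
    by move=> j jJ; rewrite /B'; case: eqP jJ kNJ => // -> ->.
  rewrite (eq_big_seq (fun j => Pr (X j @^-1` B j)))/=; last first.
    by move=> j /JB' ->.
  have -> : \bigcap_(j in [set` k :: J]) (X j @^-1` B' j) = X k @^-1` A `&` D.
    have -> : [set` k :: J] = k |` [set` J].
      by apply/seteqP; split => j /=; rewrite in_cons => /predU1P.
    rewrite bigcap_setU1 {1}/B' eqxx; congr (_ `&` _).
    by apply: eq_bigcapr => j /= /JB' ->.
  rewrite -/p pE => kJE.
  transitivity ((L ^+ k)%:E * (Pr (X k @^-1` A) * q%:E))%E.
    rewrite -kJE [RHS]integral_mkcondr; apply: eq_integral => w _.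
    by rewrite patchE /g indicE; case: ifPn => _; rewrite ?mulr1 ?mulr0.
  rewrite /mscale/= -(X_distr k mA) EFinM -muleA; congr (_ * _)%E.
  by rewrite muleC.
have mf : measurable_fun [set: measurableTypeR R]
    (fun x : measurableTypeR R => (expR (- (s * x)))%:E).
  by apply/measurable_EFinP; exact: measurable_laplace_kernel.
have f0 (x : R) : (0 <= (expR (- (s * x)))%:E)%E by rewrite lee_fin expR_ge0.
transitivity (\int[Pr]_w ((expR (- (s * X k w)))%:E * (g w)%:E))%E.
  rewrite integral_mkcond; apply: eq_integral => w _.
  rewrite patchE /g indicE -EFinM big_ord_recr/= mulrDr opprD expRD.
  by case: ifPn => _; [rewrite mulr1 mulrC|rewrite !mulr0].
rewrite (@ge0_integral_image_density _ _ _ _ _ Pr (mscale (NngNum c0) P) (X k)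
  g (fun x => (expR (- (s * x)))%:E))//.
rewrite ge0_integral_mscale// -/(laplace P s) -/p pE.
rewrite -(fineK (laplace_fin_num fs)) -/L -!EFinM exprSr /=.
  by congr EFin; ring.
by move=> _ A mA; rewrite setTI; exact: preimage_measurable.
Qed.

Lemma laplace_sum s n : (laplace P s < +oo)%E ->
  (\int[Pr]_w (expR (- (s * \sum_(i < n) X i w)))%:E =
   (fine (laplace P s) ^+ n)%:E)%E.
Proof.
move=> fs; have := @laplace_sum_on s fs n [::] (fun=> setT) isT isT.
move=> /(_ (fun=> measurableT)); rewrite big_nil mule1 => <-.
by rewrite set_nil bigcap_set0.
Qed.

End independent_sums.

(** * Cramer's theorem above the mean *)

Lemma derivable_left_upper (R : realType) (f : R -> R) (s k : R) :
  derivable f s 1 -> - derive1 f s < k ->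
  exists2 h0, 0 < h0 & forall h, 0 < h -> h < h0 -> f (s - h) < f s + h * k.
Proof.
move=> df fk; have : h^-1 *: (f (h *: 1 + s) - f s) @[h --> 0^'] --> 'D_1 f s.
  exact: df.
move/cvgrPdist_lt => /(_ (k + derive1 f s)).
rewrite -ltrBlDr sub0r => /(_ fk)/nbhs_ballP[h0 /= h00 Hh].
exists h0 => // h hgt hlt; have := Hh (- h).
rewrite /ball /= sub0r opprK gtr0_norm// oppr_eq0 gt_eqF// => /(_ hlt isT).
rewrite -derive1E /GRing.scale/= mulr1 [- h + s]addrC ltr_distlC => /andP[+ _].
by rewrite opprD addrCA subrr addr0 invrN mulNr ltrN2 ltr_pdivrMl// ltrBlDl.
Qed.

Section cramer.
Context d (Omega : measurableType d) (R : realType) (Pr : probability Omega R).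
Variables (X : nat -> {RV Pr >-> R}) (P : probability (measurableTypeR R) R).
Hypothesis X_indep : mutually_independent X.
Hypothesis X_distr :
  forall i A, measurable A -> distribution Pr (X i) A = P A.

Let S n w := \sum_(i < n) X i w.
Let above m n : set Omega := [set w | m < n%:R^-1 * S n w].

Let measurable_above m n : measurable (above m n).
Proof.
have mS : measurable_fun [set: Omega] (fun w => n%:R^-1 * S n w).
  by apply: measurable_funM => //; exact: measurable_sum.
rewrite (_ : above m n = setT `&` (fun w => n%:R^-1 * S n w) @^-1` `]m, +oo[).
  exact: mS.
by rewrite setTI; apply/seteqP; split => w /=; rewrite in_itv/= andbT.
Qed.

Let aboveE m n w : (0 < n)%N -> (w \in above m n) = (n%:R * m < S n w).
Proof.
move=> n0; rewrite -(ltr_pM2l (_ : 0 < n%:R^-1 :> R)) ?invr_gt0 ?ltr0n//.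
by rewrite mulrA mulVf ?mul1r ?pnatr_eq0 -?lt0n//; apply/idP/idP; rewrite inE.
Qed.

Let expR_pow s n : (laplace P s < +oo)%E ->
  fine (laplace P s) ^+ n = expR (n%:R * log_laplace P s).
Proof. by move=> fs; rewrite -expR_log_laplace// -expRM_natl. Qed.

Let integral_expZ s n (c : R) : 0 <= c -> (laplace P s < +oo)%E ->
  (\int[Pr]_w (c * expR (- (s * S n w)))%:E =
   (c * expR (n%:R * log_laplace P s))%:E)%E.
Proof.
move=> c0 fs; under eq_integral do rewrite EFinM.
rewrite ge0_integralZl_EFin//.
- by rewrite (laplace_sum X_indep X_distr n fs) expR_pow.
- by apply/measurable_EFinP; exact: measurable_laplace_sum.
Qed.

Let mexp s n (c : R) :
  measurable_fun [set: Omega] (fun w => (c * expR (- (s * S n w)))%:E).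
Proof.
by apply/measurable_EFinP; apply: measurable_funM => //;
  exact: measurable_laplace_sum.
Qed.

Let mind (c m : R) n : measurable_fun [set: Omega]
  (fun w => (c * \1_(above m n) w)%:E).
Proof.
by apply/measurable_EFinP; apply: measurable_funM => //;
  exact: measurable_indic.
Qed.

Let integral_indZ (c m : R) n : 0 <= c ->
  (\int[Pr]_w (c * \1_(above m n) w)%:E = c%:E * Pr (above m n))%E.
Proof.
move=> c0; under eq_integral do rewrite EFinM.
rewrite ge0_integralZl_EFin//.
- by rewrite integral_indic// setIT.
- by apply/measurable_EFinP; exact: measurable_indic.
Qed.

Lemma chernoff_mean s m n : s <= 0 -> (laplace P s < +oo)%E -> (0 < n)%N ->
  fine (Pr (above m n)) <= expR (n%:R * (s * m + log_laplace P s)).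
Proof.
move=> s0 fs n0; rewrite -lee_fin fineK ?fin_num_measure//.
rewrite -[leLHS]mul1e -(integral_indZ m n ler01).
have -> : n%:R * (s * m + log_laplace P s) =
  s * (n%:R * m) + n%:R * log_laplace P s by ring.
rewrite expRD -(integral_expZ n (expR_ge0 _) fs).
apply: ge0_le_integral => //.
move=> w _; rewrite lee_fin mul1r indicE aboveE//.
case: ltP => h; last by rewrite mulr_ge0 ?expR_ge0.
by rewrite -expRD -[leLHS]expR0 ler_expR -mulrBr mulr_le0// subr_le0 ltW.
Qed.

Let integrated_bound s1 s s2 (c c0 c1 c2 m : R) n :
  0 <= c -> 0 <= c0 -> 0 <= c1 -> 0 <= c2 -> (laplace P s1 < +oo)%E ->
  (laplace P s < +oo)%E -> (laplace P s2 < +oo)%E ->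
  (forall w, c * expR (- (s1 * S n w)) <= c0 * \1_(above m n) w +
     (c1 * expR (- (s * S n w)) + c2 * expR (- (s2 * S n w)))) ->
  c * expR (n%:R * log_laplace P s1) <= c0 * fine (Pr (above m n)) +
     (c1 * expR (n%:R * log_laplace P s) + c2 * expR (n%:R * log_laplace P s2)).
Proof.
move=> ge0 ge00 ge01 ge02 f1 fs f2 le_w.
have prK : (fine (Pr (above m n)))%:E = Pr (above m n).
  by rewrite fineK// fin_num_measure.
have e0 s' (k : R) w : 0 <= k -> (0 <= (k * expR (- (s' * S n w)))%:E)%E.
  by move=> ?; rewrite lee_fin mulr_ge0 ?expR_ge0.
pose I (s' k : R) := (\int[Pr]_w (k * expR (- (s' * S n w)))%:E)%E.
pose I0 := (\int[Pr]_w (c0 * \1_(above m n) w)%:E)%E.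
have le_I : (I s1 c <= I0 + (I s c1 + I s2 c2))%E.
  rewrite /I /I0 -ge0_integralD//; [|by move=> w _; exact: e0..].
  rewrite -ge0_integralD//; last 3 first.
  - by move=> w _; rewrite lee_fin mulr_ge0.
  - by move=> w _; rewrite adde_ge0// e0.
  - exact: emeasurable_funD.
  apply: ge0_le_integral => //.
  - by move=> w _; apply: e0.
  - by apply: emeasurable_funD => //; exact: emeasurable_funD.
  by move=> w _; rewrite -!EFinD lee_fin.
have I1E : I s1 c = _ := integral_expZ n ge0 f1.
have IE : I s c1 = _ := integral_expZ n ge01 fs.
have I2E : I s2 c2 = _ := integral_expZ n ge02 f2.
have I0E : I0 = _ := integral_indZ m n ge00.
by move: le_I; rewrite I1E IE I2E I0E -prK -EFinM -!EFinD lee_fin.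
Qed.

(** Cut the integral of [expR (- (s1 * S n))] at [n m] and [n m']. The two tails
    are bounded by moving the parameter, up to [s] below [n m] and down to [s2]
    above [n m']. *)
Let truncated_mass s2 s1 s m m' n : s2 <= s1 -> s1 <= s -> s1 <= 0 ->
  (laplace P s2 < +oo)%E -> (laplace P s1 < +oo)%E -> (laplace P s < +oo)%E ->
  (0 < n)%N ->
  expR (n%:R * log_laplace P s1) <=
    expR (- (s1 * (n%:R * m'))) * fine (Pr (above m n)) +
    (expR ((s - s1) * (n%:R * m)) * expR (n%:R * log_laplace P s) +
     expR (- ((s1 - s2) * (n%:R * m'))) * expR (n%:R * log_laplace P s2)).
Proof.
move=> s21 s1s s10 f2 f1 fs n0; rewrite -[leLHS]mul1r.
apply: integrated_bound f1 fs f2 _; rewrite ?expR_ge0//.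
move=> w; rewrite indicE aboveE// mul1r -!expRD.
set x := S n w; set a := n%:R * m; set a' := n%:R * m'.
have pos (u : R) : 0 <= expR u by exact: expR_ge0.
have [ax|xa] := ltP a x; last first.
  rewrite mulr0 add0r ler_wpDr// ler_expR; nra.
have [xa'|a'x] := leP x a'.
  by rewrite mulr1 ler_wpDr ?addr_ge0// ler_expR; nra.
by rewrite addrA ler_wpDl ?addr_ge0 ?mulr_ge0// ler_expR; nra.
Qed.

(** The two tails, divided by the total mass [laplace P s1 ^+ n], are powers of
    numbers that well chosen parameters make smaller than 1. *)
Let lower_bound s2 s1 s m m' n : s2 <= s1 -> s1 <= s -> s1 <= 0 ->
  (laplace P s2 < +oo)%E -> (laplace P s1 < +oo)%E -> (laplace P s < +oo)%E ->
  (0 < n)%N ->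
  expR (n%:R * (s1 * m' + log_laplace P s1)) *
    (1 - expR ((s - s1) * m + log_laplace P s - log_laplace P s1) ^+ n
       - expR (log_laplace P s2 - log_laplace P s1 - (s1 - s2) * m') ^+ n)
  <= fine (Pr (above m n)).
Proof.
move=> s21 s1s s10 f2 f1 fs n0.
have := truncated_mass m m' s21 s1s s10 f2 f1 fs n0.
move: (log_laplace P s1) (log_laplace P s) (log_laplace P s2) => l1 l l2.
move: (fine _) => pr.
rewrite -!expRD => h; set E := expR (s1 * (n%:R * m')).
have -> : expR (n%:R * (s1 * m' + l1)) * (1 - expR ((s - s1) * m + l - l1) ^+ n
    - expR (l2 - l1 - (s1 - s2) * m') ^+ n) =
    E * (expR (n%:R * l1) - (expR ((s - s1) * (n%:R * m) + n%:R * l) +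
         expR (- ((s1 - s2) * (n%:R * m')) + n%:R * l2))).
  rewrite opprD addrA !mulrBr mulr1 -!expRM_natl -!expRD.
  by congr (expR _ - expR _ - expR _); ring.
have E1 : E * expR (- (s1 * (n%:R * m'))) = 1 by exact: expRxMexpNx_1.
rewrite [leRHS](_ : pr = E * (expR (- (s1 * (n%:R * m'))) * pr)); last first.
  by rewrite mulrA E1 mul1r.
by rewrite (ler_pM2l (expR_gt0 _)) lerBlDr.
Qed.

(** The parameters are [s - 2 e < s - e < s] with [e] small. The strict tangent
    inequality at [s] makes the tail of the law tilted by [s - e] below [n m]
    negligible, and differentiability at [s] its tail above [n (m + dl)]. *)
Lemma cramer_lower s (eta : R) : laplace_domain P s -> s < 0 ->
  (forall t, laplace_domain P t ->
     derive1 (log_laplace P) s = derive1 (log_laplace P) t -> s = t) ->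
  0 < eta -> let m := - derive1 (log_laplace P) s in
  \forall n \near \oo,
    expR (n%:R * (s * m + log_laplace P s - eta)) / 2 <= fine (Pr (above m n)).
Proof.
move=> ds s0 inj eta0 m.
have half (x y : R) : x < 4^-1 -> y < 4^-1 -> 2^-1 <= 1 - x - y by lra.
(* Replacing [m] by [m + dl] and [s] by [s - e] costs [(e - s) * dl <= eta]. *)
pose dl := eta / (1 - s).
have dl0 : 0 < dl by rewrite divr_gt0// subr_gt0 (lt_trans s0).
have [rho rho0 near_s] := laplace_domain_itvoo ds.
have [h0 h00 left_s] : exists2 h0, 0 < h0 & forall h, 0 < h -> h < h0 ->
    log_laplace P (s - h) < log_laplace P s + h * (m + dl / 2).
  apply: derivable_left_upper; first exact: derivable_log_laplace.
  by rewrite ltrDl divr_gt0.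
pose e := Num.min 1 (Num.min rho h0) / 4.
have [e0 e1 e_rho e_h0] : [/\ 0 < e, e <= 1, 2 * e < rho & 2 * e < h0].
  have p0 : 0 < Num.min 1 (Num.min rho h0) by rewrite !lt_min ltr01 rho0.
  have : Num.min 1 (Num.min rho h0) <= 1 by rewrite ge_min lexx.
  have : Num.min 1 (Num.min rho h0) <= rho by rewrite !ge_min lexx orbT.
  have : Num.min 1 (Num.min rho h0) <= h0 by rewrite !ge_min lexx !orbT.
  rewrite /e; move: (Num.min 1 _) p0 => x *; split; lra.
have [s21 s1s s10] : [/\ s - 2 * e <= s - e, s - e <= s & s - e <= 0].
  by split; lra.
have ds1 : laplace_domain P (s - e).
  by apply: near_s; rewrite in_itv/=; apply/andP; split; lra.
have ds2 : laplace_domain P (s - 2 * e).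
  by apply: near_s; rewrite in_itv/=; apply/andP; split; lra.
have [f1 f2 fs] := And3 (laplace_domain_lt_pinfty ds1)
  (laplace_domain_lt_pinfty ds2) (laplace_domain_lt_pinfty ds).
have tan1 : log_laplace P s + e * m < log_laplace P (s - e).
  have : derive1 (log_laplace P) s != derive1 (log_laplace P) (s - e).
    apply: contraTneq e0 => /(inj _ ds1)/eqP.
    by rewrite -subr_eq0 opprB addrC subrK => /eqP ->; rewrite ltxx.
  move=> /(log_laplace_tangent_strict ds ds1).
  by rewrite [s - e - s]addrAC subrr add0r mulrN -mulNr -/m [m * e]mulrC.
have quad2 := left_s (2 * e) ltac:(by rewrite mulr_gt0) e_h0.
have small (x : R) : x < 0 -> \forall n \near \oo, expR x ^+ n < 4^-1.
  move=> x0; have : expR x ^+ n @[n --> \oo] --> (0 : R).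
    by apply: cvg_expr; rewrite ger0_norm ?expR_ge0// expR_lt1.
  by move=> /cvgr_lt; apply; rewrite invr_gt0.
have etaE : eta = dl * (1 - s) by rewrite divfK// gt_eqF// subr_gt0 (lt_trans s0).
have edl : e * dl <= dl by rewrite ler_piMl// ltW.
have [p_lt0 q_lt0 rate] : [/\
    (s - (s - e)) * m + log_laplace P s - log_laplace P (s - e) < 0,
    log_laplace P (s - 2 * e) - log_laplace P (s - e)
      - (s - e - (s - 2 * e)) * (m + dl) < 0 &
    s * m + log_laplace P s - eta <=
      (s - e) * (m + dl) + log_laplace P (s - e)].
  rewrite etaE; move: tan1 quad2 edl.
  move: (log_laplace P s) (log_laplace P (s - e)) => l l1.
  move: (log_laplace P (s - 2 * e)) => l2 *; split; lra.
near=> n.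
have n0 : (0 < n)%N by near: n; exact: nbhs_infty_gt.
apply: le_trans (lower_bound m (m + dl) s21 s1s s10 f2 f1 fs n0).
rewrite ler_pM ?expR_ge0//; first by rewrite ler_expR ler_wpM2l.
have pn : expR ((s - (s - e)) * m + log_laplace P s - log_laplace P (s - e)) ^+ n
  < 4^-1 by near: n; exact: small.
have qn : expR (log_laplace P (s - 2 * e) - log_laplace P (s - e)
  - (s - e - (s - 2 * e)) * (m + dl)) ^+ n < 4^-1 by near: n; exact: small.
exact: half.
Unshelve. all: end_near. Qed.

(** Above the mean the infimum in the Chernoff bound is attained at the negative
    [s] whose tilted law has mean [m]. *)
Theorem cramer s (m := - derive1 (log_laplace P) s) :
  laplace_domain P s -> s < 0 ->
  (forall t, laplace_domain P t ->
     derive1 (log_laplace P) s = derive1 (log_laplace P) t -> s = t) ->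
  deviation_rate X m = (- (s * m + log_laplace P s))%:E.
Proof.
move=> ds s0 inj; rewrite /deviation_rate EFinN; congr (- _)%E.
set r := s * m + log_laplace P s.
have lower eta : 0 < eta ->
    \forall n \near \oo, expR (n%:R * (r - eta)) / 2 <= fine (Pr (above m n)).
  exact: cramer_lower.
have prK n : (fine (Pr (above m n)))%:E = Pr (above m n).
  by rewrite fineK// fin_num_measure.
have pr_gt0 : \forall n \near \oo, 0 < fine (Pr (above m n)).
  near=> n; suff h : expR (n%:R * (r - 1)) / 2 <= fine (Pr (above m n)).
    by apply: lt_le_trans h; rewrite divr_gt0// expR_gt0.
  by near: n; exact: lower.
apply/cvg_lim => //.
have : n%:R^-1 * ln (fine (Pr (above m n))) @[n --> \oo] --> r.
  apply/cvgrPdist_le => eta eta0; near=> n.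
  have n0 : (0 < n)%N by near: n; exact: nbhs_infty_gt.
  have nR : 0 < n%:R :> R by rewrite ltr0n.
  have p0 : 0 < fine (Pr (above m n)) by near: n.
  have up : fine (Pr (above m n)) <= expR (n%:R * r).
    by apply: chernoff_mean => //; [exact: ltW|exact: laplace_domain_lt_pinfty].
  have lo : expR (n%:R * (r - eta / 2)) / 2 <= fine (Pr (above m n)).
    by near: n; apply: lower; rewrite divr_gt0.
  have big : ln 2 <= n%:R * (eta / 2).
    rewrite -ler_pdivrMr ?divr_gt0//; near: n; exact: nbhs_infty_ger.
  move: (fine _) p0 up lo => p p0 up lo.
  have {}up : ln p <= n%:R * r by rewrite -ler_expR lnK.
  have {lo} : n%:R * (r - eta / 2) - ln 2 <= ln p.
    by rewrite -ler_expR lnK// expRD expRN lnK// posrE.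
  rewrite ler_distlC => lo; apply/andP; split.
    rewrite ler_pdivlMl//; lra.
  by rewrite ler_pdivrMl//; nra.
move=> h.
have {}h : (n%:R^-1 * ln (fine (Pr (above m n))))%:E @[n --> \oo] --> r%:E.
  by apply: cvg_EFin => //; exact: nearW.
apply: cvg_trans h; apply: near_eq_cvg; near=> n.
rewrite -/(above m n) -prK lne_EFin ?EFinM//.
by near: n.
Unshelve. all: end_near. Qed.

End cramer.

(** * Translates, and the mean of the law *)

Section translates.
Context {R : realType}.
Implicit Types (mu : {measure set (measurableTypeR R) -> \bar R}) (s t a : R).

Lemma convolution_diracE mu a (A : set (measurableTypeR R)) : measurable A ->
  convolution mu \d_(a : measurableTypeR R) A = mu [set x | A (x + a)].
Proof.
move=> mA; have mB : measurable [set x : measurableTypeR R | A (x + a)].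
  have madd : measurable_fun [set: measurableTypeR R]
      (fun x : measurableTypeR R => x + a : measurableTypeR R).
    exact: measurable_funD.
  by rewrite -[X in measurable X]setTI; exact: madd.
transitivity (\int[mu]_x (\1_[set x | A (x + a)] x)%:E)%E; last first.
  by rewrite integral_indic// setIT.
apply: eq_integral => x _; rewrite /= diracE indicE.
by congr (_%:R%:E); congr nat_of_bool; rewrite /xsection; apply/idP/idP;
  rewrite !inE /= !inE.
Qed.

Lemma integral_convolution_dirac mu a (f : R -> \bar R) :
  measurable_fun [set: measurableTypeR R] (f : measurableTypeR R -> \bar R) ->
  (forall x, (0 <= f x)%E) ->
  (\int[convolution mu \d_(a : measurableTypeR R)]_x f x =
   \int[mu]_x f (x + a)%R)%E.
Proof.
move=> mf f0; have madd : measurable_fun [set: measurableTypeR R]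
    (fun x : measurableTypeR R => x + a : measurableTypeR R).
  exact: measurable_funD.
rewrite -(@ge0_integral_image_density _ _ _ _ _ mu
  (convolution mu \d_(a : measurableTypeR R))
  (fun x : measurableTypeR R => x + a : measurableTypeR R) (cst 1) f)//.
  by apply: eq_integral => x _; rewrite mule1.
move=> A mA; apply: etrans (esym (convolution_diracE mu a mA)).
rewrite (integral_cst mu _ 1) ?mul1e//.
by rewrite -[X in measurable X]setTI; exact: madd.
Qed.

Lemma laplace_translate_tilt mu s a t
    (P : {measure set (measurableTypeR R) -> \bar R}) :
  (forall A, measurable A ->
     P A = convolution (exp_tilt mu s) \d_(a : measurableTypeR R) A) ->
  (laplace P t =
   (expR (- (t * a) - log_laplace mu s))%:E * laplace mu (s + t))%E.
Proof.
move=> PE.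
have madd : measurable_fun [set: measurableTypeR R]
    (fun x : measurableTypeR R => x + a : measurableTypeR R).
  exact: measurable_funD.
have mexp u : measurable_fun [set: measurableTypeR R]
    (fun x : measurableTypeR R => (expR (- (u * x)))%:E).
  by apply/measurable_EFinP; exact: measurable_laplace_kernel.
rewrite /laplace -(@ge0_integral_image_density _ _ _ _ _ mu P
  (fun x : measurableTypeR R => x + a : measurableTypeR R)
  (fun x => expR (- (s * x) - log_laplace mu s)))//.
- have exp0 u (x : R) : (0 <= (expR (- (u * x)))%:E)%E.
    by rewrite lee_fin expR_ge0.
  rewrite -(ge0_integralZl_EFin mu measurableT (fun x _ => exp0 (s + t) x)
    (mexp (s + t)) (expR_ge0 _)).
  apply: eq_integral => x _; rewrite -!EFinM -!expRD; congr (expR _)%:E; ring.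
- apply: (measurableT_comp (@measurable_expR R)); apply: measurable_funB => //.
  by apply: measurableT_comp => //; exact: measurable_funM.
- by move=> A mA; rewrite PE// convolution_diracE.
Qed.

Lemma T_family_laplace_domain0 mu (P : probability (measurableTypeR R) R) :
  T_family mu P -> laplace_domain P 0.
Proof.
move=> [s [a [/laplace_domain_ball[r r0 near_s] PE]]].
apply/nbhs_ballP; exists r => // t; rewrite /ball/= sub0r normrN => tr.
rewrite (laplace_translate_tilt t PE) -ge0_fin_numE.
  rewrite fin_numM// laplace_fin_num// near_s//.
  by rewrite opprD addNKr normrN ltW.
by rewrite mule_ge0// ?laplace_ge0// lee_fin expR_ge0.
Qed.

End translates.

Lemma laplace_at0 (R : realType) (P : probability (measurableTypeR R) R) :
  laplace P 0 = 1%E.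
Proof.
rewrite /laplace; under eq_integral do rewrite mul0r oppr0 expR0.
by rewrite integral_cst// mul1e; exact: probability_setT.
Qed.

Lemma log_laplace_at0 (R : realType) (P : probability (measurableTypeR R) R) :
  log_laplace P 0 = 0.
Proof. by rewrite /log_laplace laplace_at0 ln1. Qed.

Lemma mean_log_laplace (R : realType) (P : probability (measurableTypeR R) R)
    d (Omega : measurableType d) (Pr : probability Omega R)
    (Y : {RV Pr >-> R}) :
  (forall A, measurable A -> distribution Pr Y A = P A) ->
  laplace_domain P 0 ->
  ('E_Pr[Y] = (- derive1 (log_laplace P) 0)%:E)%E.
Proof.
move=> YP d0.
have mY (A : set R) : measurable A -> measurable (Y @^-1` A).
  by move=> mA; rewrite -[_ @^-1` _]setTI; exact: measurable_funP.
have transfer (f : R -> \bar R) :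
    measurable_fun [set: measurableTypeR R] (f : measurableTypeR R -> \bar R) ->
    (forall y, 0 <= f y)%E -> (\int[Pr]_w f (Y w) = \int[P]_y f y)%E.
  move=> mf f0.
  rewrite -(@ge0_integral_image_density _ _ _ _ _ Pr P Y (cst 1) f)//.
  - by apply: eq_integral => w _; rewrite mule1.
  - by move=> _ A mA; rewrite setTI; exact: mY.
  - move=> A mA; rewrite (integral_cst Pr _ 1) ?mul1e; last exact: mY.
    exact: YP.
have intx : P.-integrable setT (EFin \o (fun x : R => x)).
  apply: (@eq_integrable _ _ _ P _ measurableT (fun x : R =>
    (-1)%:E * (- x * expR (- (0 * x)))%:E)%E).
    by move=> x _; rewrite mul0r oppr0 expR0 mulr1 -EFinM mulN1r opprK.
  by apply: integrableZl => //; exact: laplace_moment_integrable.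
(* The positive and negative parts are transferred separately: integrability is
   known under [P] only. *)
have -> : ('E_Pr[Y] = \int[P]_y (y : R)%:E)%E.
  rewrite unlock integralE [RHS]integralE; congr (_ - _)%E.
    under eq_integral do rewrite funeposE.
    under [RHS]eq_integral do rewrite funeposE.
    apply: (transfer (fun y : R => maxe y%:E 0%E)) => [|y].
      by apply: measurable_maxe => //; exact/measurable_EFinP.
    by rewrite le_max lexx orbT.
  under eq_integral do rewrite funenegE.
  under [RHS]eq_integral do rewrite funenegE.
  apply: (transfer (fun y : R => maxe (- y%:E)%E 0%E)) => [|y].
    apply: measurable_maxe => //.
    by apply: measurableT_comp => //; exact/measurable_EFinP.
  by rewrite le_max lexx orbT.
rewrite derive1_log_laplace// laplace_at0 invr1 mul1r.
rewrite (_ : (\int[P]_x (- x * expR (- (0 * x))))%R =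
             (\int[P]_x (-1 * x))%R); last first.
  by apply: eq_Rintegral => x _; rewrite mul0r oppr0 expR0 mulr1 mulN1r.
rewrite RintegralZl// mulN1r opprK fineK//.
exact: integrable_fin_num.
Qed.

(** * The formula *)

Theorem proposition6 (R : realType)
    (TF : set (probability (measurableTypeR R) R))
    (TF_exp : T_exponential_family TF)
    (TF_dual : exists TFstar, dual_T_family TF TFstar)
    (P : probability (measurableTypeR R) R) (P_TF : TF P)
    (d : measure_display) (Omega : measurableType d) (Pr : probability Omega R)
    (X : nat -> {RV Pr >-> R})
    (X_indep : mutually_independent X)
    (X_distr : forall i A, measurable A -> distribution Pr (X i) A = P A)
    (m0 : R) (X_mean : forall i, ('E_Pr[X i] = m0%:E)%E)
    (Pstar : probability (measurableTypeR R) R)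
    (P_dual : dual_measure P Pstar)
    (m : R) (m_dom : mean_domain P m) (m0_lt_m : m0 < m) :
  let s0 : R := derive1 (log_laplace Pstar) m0 in
  let c : R := m0 * derive1 (log_laplace Pstar) m0
             - log_laplace Pstar m0 in
  let Pstar_m0 :=
    convolution (mscale (expR c)%:nng Pstar) \d_(s0 : measurableTypeR R) in
  (\int[Pstar_m0]_y (expR (- (m * y)))%:E = expeR (deviation_rate X m))%E.
Proof.
have [mu [_ TFE]] := TF_exp.
have d0 : laplace_domain P 0.
  by apply: (@T_family_laplace_domain0 _ mu); rewrite -TFE.
have m0E : m0 = - derive1 (log_laplace P) 0.
  by apply: EFin_inj; rewrite -(X_mean 0%N); apply: mean_log_laplace => // A;
    exact: X_distr.
have slope0 : derive1 (log_laplace Pstar) m0 = 0.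
  have [_ _ /(_ 0 d0)] := P_dual; rewrite -m0E => /eqP.
  by rewrite oppr_eq0 => /eqP.
have [s ds mE] := m_dom.
have m_star : (laplace Pstar m < +oo)%E.
  by apply: laplace_domain_lt_pinfty; have [_ + _] := P_dual; apply.
have s_lt0 : s < 0.
  rewrite ltNge; apply/negP => s_ge0.
  have : m <= m0 by rewrite m0E -mE lerN2; exact: log_laplace_slope_le.
  by rewrite leNgt m0_lt_m.
have l0 : log_laplace P 0 = 0 := log_laplace_at0 P.
have rate : deviation_rate X m = (- (s * m + log_laplace P s))%:E.
  have inj t : laplace_domain P t ->
      derive1 (log_laplace P) s = derive1 (log_laplace P) t -> s = t.
    by move=> dt; exact: (dual_slope_inj P_dual).
  have := cramer X_indep X_distr ds s_lt0 inj.
  by rewrite mE.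
have potential : log_laplace Pstar m + s * m + log_laplace P s =
    log_laplace Pstar m0.
  rewrite (legendre_dual_constant P_dual ds d0 (ltW s_lt0) mE (esym m0E)).
  by rewrite l0 mul0r !addr0.
move=> s0 c Pstar_m0.
have mexp : measurable_fun [set: measurableTypeR R]
    (fun y : measurableTypeR R => (expR (- (m * y)))%:E).
  by apply/measurable_EFinP; exact: measurable_laplace_kernel.
have exp0 (y : R) : (0 <= (expR (- (m * y)))%:E)%E by rewrite lee_fin expR_ge0.
rewrite (integral_convolution_dirac _ _ mexp exp0) /s0 slope0.
under eq_integral do rewrite addr0.
rewrite ge0_integral_mscale//.
rewrite -/(laplace Pstar m) -(fineK (laplace_fin_num m_star)).
rewrite -(expR_log_laplace m_star) rate /= -EFinM -expRD.
congr (expR _)%:E; rewrite /c slope0 mulr0 sub0r -potential.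
by move: (log_laplace _ _) (log_laplace _ _) => x y; ring.
Qed.
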